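(* Let $0<|q|<1$, $0<|p|<1$, $0<|x|<1$, $0<|y|<1$. (I) Let $a,b,c,d\in\mathbb{C}$ with $p^{c}\neq p^{-n}$ and $q^{d}\ne q^{-n}$ for all integers $n\ge 0$. If $q^{d-1}\ne 1$, then $$x\mathbb{D}_{x,q}\Psi_{1}(q^{a},p^{b};p^{c},q^{d};q,p,x,y)=\frac{1-q^{d-1}}{(1-q)q^{d-1}}\Big[\Psi_{1}(q^{a},p^{b};p^{c},q^{d-1};q,p,x,y)-\Psi_{1}(q^{a},p^{b};p^{c},q^{d};q,p,x,y)\Big].$$ Moreover $$y\mathbb{D}_{y,p}\Psi_{1}(q^{a},p^{b};p^{c},q^{d};q,p,x,y)=\frac{1-p^{b}}{(1-p)p^{b}}\Big[\Psi_{1}(q^{a},p^{b+1};p^{c},q^{d};q,p,x,y)-\Psi_{1}(q^{a},p^{b};p^{c},q^{d};q,p,x,y)\Big],$$ and, if $p^{c-1}\neq 1$, $$y\mathbb{D}_{y,p}\Psi_{1}(q^{a},p^{b};p^{c},q^{d};q,p,x,y)=\frac{1-p^{c-1}}{(1-p)p^{c-1}}\Big[\Psi_{1}(q^{a},p^{b};p^{c-1},q^{d};q,p,x,y)-\Psi_{1}(q^{a},p^{b};p^{c},q^{d};q,p,x,y)\Big].$$ (II) Let $a,b,c\in\mathbb{C}$ with $p^{b}\neq p^{-n}$ and $q^{c}\ne q^{-n}$ for all integers $n\ge 0$. If $q^{c-1}\neq1$, then $$x\mathbb{D}_{x,q}\Psi_{2}(q^{a};p^{b},q^{c};q,p,x,y)=\frac{1-q^{c-1}}{(1-q)q^{c-1}}\Big[\Psi_{2}(q^{a};p^{b},q^{c-1};q,p,x,y)-\Psi_{2}(q^{a};p^{b},q^{c};q,p,x,y)\Big],$$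 and if $p^{b-1}\ne1$, then $$y\mathbb{D}_{y,p}\Psi_{2}(q^{a};p^{b},q^{c};q,p,x,y)=\frac{1-p^{b-1}}{(1-p)p^{b-1}}\Big[\Psi_{2}(q^{a};p^{b-1},q^{c};q,p,x,y)-\Psi_{2}(q^{a};p^{b},q^{c};q,p,x,y)\Big].$$
   Context: $q,p\in\mathbb{C}$ are two independent bases with $0<|q|<1$, $0<|p|<1$; logarithms of $q$ and $p$ are fixed so that $q^{a}=e^{a\log q}$, $p^{b}=e^{b\log p}$ for complex exponents. The $q$-shifted factorial is $(A;q)_{0}=1$, $(A;q)_{k}=\prod_{r=0}^{k-1}(1-Aq^{r})$ for $k\ge1$ (similarly with base $p$). The $q$-difference operator in a variable $x$ is $\mathbb{D}_{x,q}f(x)=\dfrac{f(x)-f(qx)}{(1-q)x}$, $x\ne0$ (other variables fixed); $\mathbb{D}_{y,p}$ is the analogue with variable $y$ and base $p$. The bibasic Humbert functions are, for $|x|,|y|<1$ and whenever no denominator factor vanishes, $$\Psi_{1}(q^{a},p^{b};p^{c},q^{d};q,p,x,y)=\sum_{\ell,k=0}^{\infty}\frac{(q^{a};q)_{k+\ell}(p^{b};p)_{\ell}}{(p^{c};p)_{\ell}(q^{d};q)_{k}(q;q)_{k}(p;p)_{\ell}}x^{k}y^{\ell},$$ $$\Psi_{2}(q^{a};p^{b},q^{c};q,p,x,y)=\sum_{\ell,k=0}^{\infty}\frac{(q^{a};q)_{k+\ell}}{(p^{b};p)_{\ell}(q^{c};q)_{k}(q;q)_{k}(p;p)_{\ell}}x^{k}y^{\ell}.$$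 *)

(* Defs.v *)
From Stdlib Require Import Reals.
From Coquelicot Require Import Coquelicot.

Open Scope C_scope.

Definition Cexp (z : C) : C :=
  ((exp (Re z) * cos (Im z))%R, (exp (Re z) * sin (Im z))%R).

(* The power [q^a] of a base [q] whose logarithm has been fixed to be [lq]. *)
Definition cpow (lq a : C) : C := Cexp (a * lq).

(* [(A; q)_n], the product of the [1 - A q^r] for [0 <= r < n]. *)
Fixpoint qpoch (A q : C) (n : nat) : C :=
  match n with
  | O => 1
  | S m => qpoch A q m * (1 - A * q ^ m)
  end.

Definition qdiff (q : C) (f : C -> C) (x : C) : C :=
  (f x - f (q * x)) / ((1 - q) * x).

(* A double series converges to [s] when its rectangular partial sums tend to
   [s] as both bounds tend to infinity independently. *)
Definition is_dseries (u : nat -> nat -> C) (s : C) : Prop :=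
  filterlim
    (fun N : nat * nat =>
       sum_n (fun l : nat => sum_n (fun k : nat => u l k) (snd N)) (fst N))
    (filter_prod eventually eventually) (locally s).

(* The limit is unique; the value is meaningful only if the series converges. *)
Definition dseries (u : nat -> nat -> C) : C :=
  iota (T := C_CompleteNormedModule) (is_dseries u).

(* The parameters [qa], [pb], ... are the values of the powers [q^a], [p^b], ...;
   in the double series the first index is [l], the second [k]. *)
Definition Psi1 (qa pb pc qd q p x y : C) : C :=
  dseries (fun l k : nat =>
    (qpoch qa q (k + l) * qpoch pb p l) /
    (qpoch pc p l * qpoch qd q k * qpoch q q k * qpoch p p l)
    * x ^ k * y ^ l).

Definition Psi2 (qa pb qc q p x y : C) : C :=
  dseries (fun l k : nat =>
    qpoch qa q (k + l) /
    (qpoch pb p l * qpoch qc q k * qpoch q q k * qpoch p p l)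
    * x ^ k * y ^ l).

(* Main.v *)
(** When the parameters avoid the poles, the [q]-shifted factorials are bounded
    and bounded away from 0 where they occur as denominators, so the double
    series are dominated by a product of geometric series and converge
    in the rectangular sense. Each formula then holds term by
    term: [x D_(x,q)] multiplies the coefficient of [x^k] by [(1 - q^k)/(1 - q)],
    and the contiguous parameter produces the same factor through
    [(1 - A) (A q; q)_k = (A; q)_k (1 - A q^k)]. *)
Require Import Defs.
From Stdlib Require Import Reals Lra Lia Arith.
From Coquelicot Require Import Coquelicot.

Open Scope C_scope.

(** * The complex exponential and powers of a base *)

Lemma Cexp_plus (z w : C) : Cexp (z + w) = Cexp z * Cexp w.
Proof.
  unfold Cexp, Cmult; rewrite re_plus, im_plus, exp_plus, cos_plus, sin_plus.
  apply injective_projections; simpl; ring.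
Qed.

Lemma Cexp_neq_0 (z : C) : Cexp z <> 0.
Proof.
  unfold Cexp; intros E; injection E; intros Es Ec.
  assert (He := exp_pos (Re z)).
  assert (Hsc := sin2_cos2 (Im z)); unfold Rsqr in Hsc.
  destruct (Rmult_integral _ _ Es), (Rmult_integral _ _ Ec); nra.
Qed.

Lemma cpow_plus_1 (lq q a : C) : Cexp lq = q -> cpow lq (a + 1) = cpow lq a * q.
Proof.
  intros <-; unfold cpow; rewrite <- Cexp_plus; f_equal; ring.
Qed.

Lemma cpow_minus_1 (lq q a : C) : Cexp lq = q -> cpow lq a = cpow lq (a - 1) * q.
Proof.
  intros Hq; rewrite <- (cpow_plus_1 lq q _ Hq); f_equal; ring.
Qed.

(** * Algebra and nonvanishing of shifted factorials *)

Lemma qpoch_shift (A q : C) (n : nat) :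
  (1 - A) * qpoch (A * q) q n = qpoch A q n * (1 - A * q ^ n).
Proof.
  induction n as [|n IH]; simpl; [ring|].
  rewrite Cmult_assoc, IH; ring.
Qed.

Lemma qpoch_neq_0 (A q : C) (n : nat) :
  (forall r, A * q ^ r <> 1) -> qpoch A q n <> 0.
Proof.
  intros H; induction n as [|n IH]; simpl.
  - intros E; injection E; lra.
  - apply Cmult_neq_0; [exact IH|].
    intros E; apply (H n); replace (A * q ^ n) with (1 - (1 - A * q ^ n)) by ring.
    rewrite E; ring.
Qed.

Lemma qpoch_0_l (q : C) (n : nat) : qpoch 0 q n = 1.
Proof.
  induction n as [|n IH]; simpl; [reflexivity|rewrite IH; ring].
Qed.

Lemma Cmod_pow_le_1 (q : C) (n : nat) : (Cmod q < 1)%R -> (Cmod (q ^ n) <= 1)%R.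
Proof.
  intros Hq; rewrite Cmod_pow; rewrite <- (pow1 n).
  apply pow_incr; split; [apply Cmod_ge_0|lra].
Qed.

(** This keeps [(q; q)_k] and [(p; p)_l], which stand in every denominator, away from zero. *)
Lemma mult_pow_neq_1 (q : C) (n : nat) : (Cmod q < 1)%R -> q * q ^ n <> 1.
Proof.
  intros Hq E; apply (f_equal Cmod) in E.
  rewrite Cmod_mult, Cmod_1 in E.
  assert (H := Cmod_pow_le_1 q n Hq); assert (H1 := Cmod_ge_0 q).
  assert (H2 := Cmod_ge_0 (q ^ n)); nra.
Qed.

(** * Uniform bounds for shifted factorials and their reciprocals *)

Lemma sum_n_geom_bound (r : R) (n : nat) :
  (0 <= r < 1)%R -> (sum_n (fun k => r ^ k) n <= / (1 - r))%R.
Proof.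
  intros Hr; rewrite sum_n_Reals, tech3 by lra.
  assert (H := pow_le r (S n) (proj1 Hr)).
  unfold Rdiv; rewrite <- (Rmult_1_l (/ (1 - r))) at 2.
  apply Rmult_le_compat_r; [left; apply Rinv_0_lt_compat|]; lra.
Qed.

(* [prod (1 + c r^k) <= exp (c * sum r^k)] *)
Lemma growth_bounded (w : nat -> R) (c r : R) :
  (0 <= c)%R -> (0 <= r < 1)%R -> (forall n, 0 <= w n)%R ->
  (forall n, w (S n) <= w n * (1 + c * r ^ n))%R ->
  exists M, forall n, (w n <= M)%R.
Proof.
  intros Hc Hr Hw Hs; exists (w 0%nat * exp (c * / (1 - r)))%R.
  assert (Hexp : forall s, (0 <= s <= / (1 - r) -> exp (c * s) <= exp (c * / (1 - r)))%R).
  { intros s Hsr; destruct (Rle_lt_or_eq_dec (c * s) (c * / (1 - r))) as [H|H].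
    - apply Rmult_le_compat_l; lra.
    - left; apply exp_increasing, H.
    - rewrite H; lra. }
  (* Each factor is absorbed by [1 + t <= exp t]. Since [sum_n] includes its upper index, the sum up
     to [n] controls [w (S n)], and [w 0] is treated apart. *)
  assert (Hb : forall n, (w (S n) <= w 0%nat * exp (c * sum_n (fun k => r ^ k) n))%R).
  { induction n as [|n IH].
    - rewrite sum_O; eapply Rle_trans; [apply Hs|].
      apply Rmult_le_compat_l; [apply Hw|apply exp_ineq1_le].
    - rewrite sum_Sn; change (@plus R_AbelianMonoid) with Rplus.
      rewrite Rmult_plus_distr_l, exp_plus, <- Rmult_assoc.
      eapply Rle_trans; [apply Hs|].
      apply Rmult_le_compat; [apply Hw| |exact IH|apply exp_ineq1_le].
      assert (H := pow_le r (S n) (proj1 Hr)); nra. }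
  assert (Hi : (0 < / (1 - r))%R) by (apply Rinv_0_lt_compat; lra).
  intros [|n].
  - assert (H := Hexp 0%R); rewrite Rmult_0_r, exp_0 in H.
    assert (H0 := Hw 0%nat); nra.
  - eapply Rle_trans; [apply Hb|].
    apply Rmult_le_compat_l; [apply Hw|]; apply Hexp; split.
    + rewrite sum_n_Reals; apply cond_pos_sum; intros k; apply pow_le, Hr.
    + apply sum_n_geom_bound, Hr.
Qed.

(** The factor [1 - A q^n] has modulus at most [1 + |A| |q|^n], which is the growth allowed by
    [growth_bounded]. *)
Lemma qpoch_bounded (A q : C) :
  (Cmod q < 1)%R -> exists M, forall n, (Cmod (qpoch A q n) <= M)%R.
Proof.
  intros Hq; apply (growth_bounded _ (Cmod A) (Cmod q)).
  - apply Cmod_ge_0.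
  - split; [apply Cmod_ge_0|exact Hq].
  - intros n; apply Cmod_ge_0.
  - intros n; simpl; rewrite Cmod_mult.
    apply Rmult_le_compat_l; [apply Cmod_ge_0|].
    unfold Cminus; eapply Rle_trans; [apply Cmod_triangle|].
    rewrite Cmod_opp, Cmod_mult, Cmod_1, Cmod_pow; lra.
Qed.

(** Induction on the threshold [N]: each step lowers it by one and absorbs the term [v N] into the
    minimum. *)
Lemma pos_seq_lower_bound (v : nat -> R) (m : R) (N : nat) :
  (forall n, 0 < v n)%R -> (0 < m)%R -> (forall n, (N <= n)%nat -> m <= v n)%R ->
  exists d, (0 < d)%R /\ forall n, (d <= v n)%R.
Proof.
  intros Hv; revert m; induction N as [|N IH]; intros m Hm HN.
  - exists m; split; [exact Hm|intros n; apply HN; lia].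
  - apply (IH (Rmin m (v N))).
    + apply Rmin_glb_lt; [exact Hm|apply Hv].
    + intros n Hn; destruct (Nat.eq_dec n N) as [->|Hne].
      * apply Rmin_r.
      * eapply Rle_trans; [apply Rmin_l|apply HN; lia].
Qed.

(** Since [A q^n] tends to 0, the factors eventually have modulus at least 1/2, and the finitely
    many earlier ones are nonzero. *)
Lemma qpoch_factor_lower_bound (A q : C) :
  (Cmod q < 1)%R -> (forall r, A * q ^ r <> 1) ->
  exists d, (0 < d)%R /\ forall n, (d <= Cmod (1 - A * q ^ n))%R.
Proof.
  intros Hq HA.
  (* This tolerance gives [|A q^n| <= 1/2]; the [+ 1] keeps the divisor positive when [A = 0]. *)
  destruct (pow_lt_1_zero (Cmod q)) with (y := (/ 2 / (Cmod A + 1))%R) as [N HN].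
  - rewrite Rabs_pos_eq; [exact Hq|apply Cmod_ge_0].
  - assert (H := Cmod_ge_0 A); apply Rdiv_lt_0_compat; lra.
  - apply (pos_seq_lower_bound _ (/ 2) N); [|lra|].
    + intros n; apply Cmod_gt_0; intros E; apply (HA n).
      replace (A * q ^ n) with (1 - (1 - A * q ^ n)) by ring; rewrite E; ring.
    + intros n Hn; specialize (HN n Hn).
      rewrite Rabs_pos_eq in HN by (apply pow_le, Cmod_ge_0).
      assert (H := Cmod_ge_0 A).
      assert (HAq : (Cmod (A * q ^ n) <= / 2)%R).
      { rewrite Cmod_mult, Cmod_pow.
        apply Rle_trans with ((Cmod A + 1) * (/ 2 / (Cmod A + 1)))%R.
        - apply Rmult_le_compat; [lra|apply pow_le, Cmod_ge_0|lra|lra].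
        - right; field; lra. }
      assert (Ht := Cmod_triangle (1 - A * q ^ n) (A * q ^ n)).
      replace (1 - A * q ^ n + A * q ^ n) with (RtoC 1) in Ht by ring.
      rewrite Cmod_1 in Ht; lra.
Qed.

(** With [d] a lower bound for the factors, passing from [n] to [n + 1] multiplies the reciprocal by
    at most [1 + (|A| / d) |q|^n] in modulus, so [growth_bounded] applies again. *)
Lemma qpoch_inv_bounded (A q : C) :
  (Cmod q < 1)%R -> (forall r, A * q ^ r <> 1) ->
  exists M, forall n, (Cmod (/ qpoch A q n) <= M)%R.
Proof.
  intros Hq HA; destruct (qpoch_factor_lower_bound A q Hq HA) as (d & Hd & Hdn).
  apply (growth_bounded _ (Cmod A / d) (Cmod q)).
  - apply Rdiv_le_0_compat; [apply Cmod_ge_0|exact Hd].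
  - split; [apply Cmod_ge_0|exact Hq].
  - intros n; apply Cmod_ge_0.
  - intros n; assert (Hz : 1 - A * q ^ n <> 0).
    { apply Cmod_gt_0; eapply Rlt_le_trans; [exact Hd|apply Hdn]. }
    assert (Hp := qpoch_neq_0 A q n HA); simpl.
    (* [1 / (1 - z) = 1 + z / (1 - z)] *)
    replace (/ (qpoch A q n * (1 - A * q ^ n)))
      with (/ qpoch A q n * (1 + A * q ^ n * / (1 - A * q ^ n))) by (field; auto).
    rewrite Cmod_mult; apply Rmult_le_compat_l; [apply Cmod_ge_0|].
    eapply Rle_trans; [apply Cmod_triangle|].
    rewrite Cmod_1, !Cmod_mult, Cmod_pow, Cmod_inv by exact Hz.
    apply Rplus_le_compat_l.
    replace (Cmod A / d * Cmod q ^ n)%R with (Cmod A * Cmod q ^ n * / d)%R by (field; lra).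
    apply Rmult_le_compat_l.
    + apply Rmult_le_pos; [apply Cmod_ge_0|apply pow_le, Cmod_ge_0].
    + apply Rinv_le_contravar; [exact Hd|apply Hdn].
Qed.

(** * Convergence of dominated double series *)

(** The monoid is left general so that complex terms and their real majorants share the same
    rectangular sums. *)
Definition dsum {G : AbelianMonoid} (u : nat -> nat -> G) (N M : nat) : G :=
  sum_n (fun l => sum_n (fun k => u l k) M) N.

Lemma dsum_Sr {G : AbelianMonoid} (u : nat -> nat -> G) (N M : nat) :
  dsum u N (S M) = plus (dsum u N M) (sum_n (fun l => u l (S M)) N).
Proof.
  unfold dsum; rewrite <- sum_n_plus; apply sum_n_ext; intros l; apply sum_Sn.
Qed.

Lemma Cmod_sum_n_le (u : nat -> C) (b : nat -> R) (n : nat) :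
  (forall k, Cmod (u k) <= b k)%R ->
  (Cmod (@sum_n C_AbelianMonoid u n) <= sum_n b n)%R.
Proof.
  intros H; induction n as [|n IH].
  - rewrite !sum_O; apply H.
  - rewrite !sum_Sn; eapply Rle_trans; [apply Cmod_triangle|].
    apply Rplus_le_compat; [exact IH|apply H].
Qed.

(** The triangle inequality on the L-shaped region between two nested rectangles. The rectangle is
    enlarged first in [l] with [M] fixed, then in [k], one line of terms at a time. *)
Lemma dsum_increment_le (u : nat -> nat -> C) (b : nat -> nat -> R) (N M i j : nat) :
  (forall l k, Cmod (u l k) <= b l k)%R ->
  (Cmod (@dsum C_AbelianMonoid u (i + N) (j + M) - @dsum C_AbelianMonoid u N M)
   <= dsum b (i + N) (j + M) - dsum b N M)%R.
Proof.
  intros H.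
  assert (Hi : (Cmod (@dsum C_AbelianMonoid u (i + N) M - @dsum C_AbelianMonoid u N M)
                <= dsum b (i + N) M - dsum b N M)%R).
  { induction i as [|i IH].
    - simpl Nat.add; replace (_ - _) with (RtoC 0) by ring; rewrite Cmod_0; lra.
    - simpl Nat.add; unfold dsum at 1 3; rewrite !sum_Sn; fold (@dsum C_AbelianMonoid u (i + N) M).
      fold (dsum b (i + N) M).
      change (@plus C_AbelianMonoid) with Cplus; change (@plus R_AbelianMonoid) with Rplus.
      match goal with |- (Cmod (?a + ?r - ?c) <= _)%R =>
        replace (a + r - c) with (a - c + r) by ring end.
      eapply Rle_trans; [apply Cmod_triangle|].
      assert (Hr := Cmod_sum_n_le (fun k => u (S (i + N)) k) (fun k => b (S (i + N)) k) M (H (S (i + N)))).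
      lra. }
  induction j as [|j IH]; [exact Hi|].
  simpl Nat.add; rewrite !dsum_Sr.
  change (@plus C_AbelianMonoid) with Cplus; change (@plus R_AbelianMonoid) with Rplus.
  match goal with |- (Cmod (?a + ?r - ?c) <= _)%R =>
    replace (a + r - c) with (a - c + r) by ring end.
  eapply Rle_trans; [apply Cmod_triangle|].
  assert (Hr := Cmod_sum_n_le (fun l => u l (S (j + M))) (fun l => b l (S (j + M))) (i + N)
                  (fun l => H l (S (j + M)))).
  lra.
Qed.

(** Cauchy's criterion in the complete space of complex numbers: increments of [u] are controlled by
    those of the convergent majorant. *)
Lemma dominated_ex_dseries (u : nat -> nat -> C) (b : nat -> nat -> R) (L : R) :
  (forall l k, Cmod (u l k) <= b l k)%R ->
  filterlim (fun N : nat * nat => dsum b (fst N) (snd N))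
    (filter_prod eventually eventually) (locally L) ->
  exists s, is_dseries u s.
Proof.
  intros Hub HL; unfold is_dseries.
  apply (proj1 (filterlim_locally_cauchy
    (U := CompleteNormedModule.CompleteSpace C_AbsRing C_CompleteNormedModule)
    (F := filter_prod eventually eventually) _)); intros eps.
  assert (He : (0 < eps / 4)%R) by (destruct eps; simpl; lra).
  destruct (proj1 (filterlim_locally _ _) HL (mkposreal _ He)) as [P Q [n1 H1] [n2 H2] HPQ].
  simpl in HPQ; set (n := Nat.max n1 n2).
  assert (Hb : forall N M, (n <= N)%nat -> (n <= M)%nat -> (Rabs (dsum b N M - L) < eps / 4)%R).
  { intros N M HN HM; apply (HPQ N M); [apply H1|apply H2]; lia. }
  (* Both majorant sums lie within [eps / 4] of [L], so they differ by less than [eps / 2]. *)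
  assert (Hu : forall N M, (n <= N)%nat -> (n <= M)%nat ->
    (Cmod (@dsum C_AbelianMonoid u N M - @dsum C_AbelianMonoid u n n) < eps / 2)%R).
  { intros N M HN HM.
    assert (Hd := dsum_increment_le u b n n (N - n) (M - n) Hub).
    rewrite !Nat.sub_add in Hd by assumption.
    assert (Ha := Rabs_def2 _ _ (Hb N M HN HM)).
    assert (Hc := Rabs_def2 _ _ (Hb n n (le_n _) (le_n _))); lra. }
  exists (fun N => n <= fst N /\ n <= snd N)%nat; split.
  - exists (fun N => n <= N)%nat (fun N => n <= N)%nat; [exists n|exists n|]; auto.
  - intros [N M] [N' M'] [HN HM] [HN' HM']; simpl in *.
    apply (norm_compat1 (V := C_NormedModule)).
    change (Cmod (@dsum C_AbelianMonoid u N' M' - @dsum C_AbelianMonoid u N M) < eps)%R.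
    (* Neither rectangle need contain the other, so both are compared with the [n] by [n] square
       inside them. *)
    replace (@dsum C_AbelianMonoid u N' M' - @dsum C_AbelianMonoid u N M)
      with (@dsum C_AbelianMonoid u N' M' - @dsum C_AbelianMonoid u n n
            + - (@dsum C_AbelianMonoid u N M - @dsum C_AbelianMonoid u n n)) by ring.
    eapply Rle_lt_trans; [apply Cmod_triangle|]; rewrite Cmod_opp.
    assert (Ha := Hu N M HN HM); assert (Hb' := Hu N' M' HN' HM'); lra.
Qed.

(** The rectangular partial sum factors into two geometric partial sums, one for each bound, whose
    limits multiply. *)
Lemma dsum_geom_lim (K r t : R) :
  (0 <= r < 1)%R -> (0 <= t < 1)%R ->
  filterlim (fun N : nat * nat => dsum (fun l k => K * r ^ k * t ^ l)%R (fst N) (snd N))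
    (filter_prod eventually eventually) (locally (K * / (1 - r) * / (1 - t))%R).
Proof.
  intros Hr Ht.
  apply filterlim_ext with (fun N : nat * nat =>
    (K * sum_n (fun k => r ^ k)%R (snd N) * sum_n (fun l => t ^ l)%R (fst N))%R).
  { intros [N M]; unfold dsum; simpl.
    rewrite <- (sum_n_mult_l (K := R_Ring)); apply sum_n_ext; intros l.
    rewrite <- (sum_n_mult_l (K := R_Ring)), <- (sum_n_mult_r (K := R_Ring)).
    reflexivity. }
  assert (Hgeom : forall z, (0 <= z < 1)%R ->
    filterlim (sum_n (fun k => z ^ k)%R) eventually (locally (/ (1 - z))%R)).
  { intros z Hz; apply is_series_geom; rewrite Rabs_pos_eq; lra. }
  apply (filterlim_comp_2 (G := locally (K * / (1 - r))%R) (H := locally (/ (1 - t))%R)).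
  - apply (filterlim_comp_2 (G := locally K) (H := locally (/ (1 - r))%R)).
    + apply filterlim_const.
    + eapply filterlim_comp; [apply filterlim_snd|apply Hgeom, Hr].
    + apply (filterlim_scal (V := R_NormedModule)).
  - eapply filterlim_comp; [apply filterlim_fst|apply Hgeom, Ht].
  - apply (filterlim_scal (V := R_NormedModule)).
Qed.

(** * Values of double series and linear relations between them *)

Lemma is_dseries_lin (u v : nat -> nat -> C) (c s t : C) :
  is_dseries u s -> is_dseries v t ->
  is_dseries (fun l k => u l k + c * v l k) (s + c * t).
Proof.
  intros Hu Hv; unfold is_dseries.
  apply filterlim_ext with (fun N : nat * nat =>
    @dsum C_AbelianMonoid u (fst N) (snd N) + c * @dsum C_AbelianMonoid v (fst N) (snd N)).
  { intros [N M]; unfold dsum; simpl.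
    rewrite <- (sum_n_mult_l (K := C_Ring) c), <- (sum_n_plus (G := C_AbelianMonoid)).
    apply sum_n_ext; intros l.
    rewrite <- (sum_n_mult_l (K := C_Ring) c), <- (sum_n_plus (G := C_AbelianMonoid)).
    reflexivity. }
  apply (filterlim_comp_2 (G := locally (T := C_NormedModule) s)
    (H := locally (T := C_NormedModule) (c * t))).
  - exact Hu.
  - eapply filterlim_comp; [exact Hv|apply (filterlim_scal_r (V := C_NormedModule))].
  - apply (filterlim_plus (V := C_NormedModule)).
Qed.

Lemma is_dseries_unique (u : nat -> nat -> C) (s : C) :
  is_dseries u s -> dseries u = s.
Proof.
  intros Hs; apply (iota_unique (V := C_CompleteNormedModule)); [|exact Hs].
  intros t Ht; exact (filterlim_locally_unique (V := C_NormedModule)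
    (F := filter_prod eventually eventually)
    (fun N : nat * nat => @dsum C_AbelianMonoid u (fst N) (snd N)) t s Ht Hs).
Qed.

Lemma is_dseries_ext (u v : nat -> nat -> C) (s : C) :
  (forall l k, u l k = v l k) -> is_dseries u s -> is_dseries v s.
Proof.
  intros H Hs; eapply filterlim_ext; [|exact Hs]; intros N; simpl.
  apply sum_n_ext; intros l; apply sum_n_ext; intros k; apply H.
Qed.

Lemma dseries_ext (u v : nat -> nat -> C) :
  (forall l k, u l k = v l k) -> (exists s, is_dseries u s) -> dseries u = dseries v.
Proof.
  intros H [s Hs]; rewrite (is_dseries_unique u s Hs); symmetry.
  apply is_dseries_unique, (is_dseries_ext u); assumption.
Qed.

(** The common shape of all the formulas: [u] holds the terms at the given point, [u'] those at the
    dilated point, and [v] those with the contiguous parameter. *)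
Lemma dseries_relation (u u' v : nat -> nat -> C) (c : C) :
  (exists s, is_dseries u s) -> (exists s, is_dseries u' s) -> (exists s, is_dseries v s) ->
  (forall l k, u l k - u' l k = c * (v l k - u l k)) ->
  dseries u - dseries u' = c * (dseries v - dseries u).
Proof.
  intros [s Hs] [s' Hs'] [t Ht] H.
  rewrite (is_dseries_unique _ _ Hs), (is_dseries_unique _ _ Hs'), (is_dseries_unique _ _ Ht).
  (* The termwise relation is solved for [u'], which becomes a linear combination of [u] and [v]. *)
  assert (E : dseries u' = s + - c * (t + - (1) * s)).
  { apply is_dseries_unique.
    apply (is_dseries_ext (fun l k => u l k + - c * (v l k + - (1) * u l k))).
    2: apply is_dseries_lin, is_dseries_lin; assumption.
    intros l k; replace (u' l k) with (u l k - (u l k - u' l k)) by ring; rewrite H; ring. }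
  rewrite (is_dseries_unique _ _ Hs') in E; rewrite E; ring.
Qed.

(** * Convergence of [Psi1] and its contiguous relations *)

(** Each of the six factorials contributes a constant, leaving the majorant [K |x|^k |y|^l]. The
    numerator parameters are arbitrary, so that [B = 0] can later cover [Psi2]. *)
Lemma Psi1_ex_dseries (A B C' D q p x y : C) :
  (Cmod q < 1)%R -> (Cmod p < 1)%R -> (Cmod x < 1)%R -> (Cmod y < 1)%R ->
  (forall n, C' * p ^ n <> 1) -> (forall n, D * q ^ n <> 1) ->
  exists s, is_dseries (fun l k : nat =>
    (qpoch A q (k + l) * qpoch B p l) /
    (qpoch C' p l * qpoch D q k * qpoch q q k * qpoch p p l)
    * x ^ k * y ^ l) s.
Proof.
  intros Hq Hp Hx Hy HC HD.
  assert (Hqq := fun n => mult_pow_neq_1 q n Hq).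
  assert (Hpp := fun n => mult_pow_neq_1 p n Hp).
  destruct (qpoch_bounded A q Hq) as [M1 H1].
  destruct (qpoch_bounded B p Hp) as [M2 H2].
  destruct (qpoch_inv_bounded C' p Hp HC) as [M3 H3].
  destruct (qpoch_inv_bounded D q Hq HD) as [M4 H4].
  destruct (qpoch_inv_bounded q q Hq Hqq) as [M5 H5].
  destruct (qpoch_inv_bounded p p Hp Hpp) as [M6 H6].
  eapply dominated_ex_dseries;
    [|apply (dsum_geom_lim (M1 * M2 * (M3 * M4 * M5 * M6)) (Cmod x) (Cmod y));
      (split; [apply Cmod_ge_0|assumption])].
  intros l k; simpl.
  assert (P3 := qpoch_neq_0 C' p l HC); assert (P4 := qpoch_neq_0 D q k HD).
  assert (P5 := qpoch_neq_0 q q k Hqq); assert (P6 := qpoch_neq_0 p p l Hpp).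
  replace (qpoch A q (k + l) * qpoch B p l /
      (qpoch C' p l * qpoch D q k * qpoch q q k * qpoch p p l))
    with (qpoch A q (k + l) * qpoch B p l *
      (/ qpoch C' p l * / qpoch D q k * / qpoch q q k * / qpoch p p l)) by (field; auto).
  rewrite !Cmod_mult, !Cmod_pow.
  repeat apply Rmult_le_compat; auto using Rle_refl;
    repeat apply Rmult_le_pos; auto using Cmod_ge_0, pow_le.
Qed.

Lemma Cmod_mult_lt_1 (q x : C) : (Cmod q < 1)%R -> (Cmod x < 1)%R -> (Cmod (q * x) < 1)%R.
Proof.
  intros Hq Hx; rewrite Cmod_mult.
  assert (H1 := Cmod_ge_0 q); assert (H2 := Cmod_ge_0 x); nra.
Qed.

Lemma Cmod_lt_1_neq_1 (q : C) : (Cmod q < 1)%R -> 1 - q <> 0.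
Proof.
  intros Hq E; apply (mult_pow_neq_1 q 0 Hq); simpl.
  replace (q * 1) with (1 - (1 - q)) by ring; rewrite E; ring.
Qed.

Lemma Cminus_neq_0 (z : C) : z <> 1 -> 1 - z <> 0.
Proof.
  intros Hz E; apply Hz; replace z with (1 - (1 - z)) by ring; rewrite E; ring.
Qed.

Lemma mult_qdiff (q x s : C) (f : C -> C) :
  1 - q <> 0 -> x <> 0 -> f x - f (q * x) = s -> x * qdiff q f x = s / (1 - q).
Proof.
  intros Hq Hx <-; unfold qdiff; field; auto.
Qed.

Lemma neq_1_shift (E q : C) :
  (forall n, E * q ^ n <> 1) -> forall n, E * q * q ^ n <> 1.
Proof.
  intros H n; rewrite <- Cmult_assoc; apply (H (S n)).
Qed.

(** This expresses the contiguous denominator through the original one, so that only one factorial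
    in the varied parameter remains. *)
Lemma qpoch_unshift (E q : C) (n : nat) :
  (forall r, E * q ^ r <> 1) ->
  qpoch E q n = (1 - E) * qpoch (E * q) q n / (1 - E * q ^ n).
Proof.
  intros H; rewrite qpoch_shift; field; apply Cminus_neq_0, H.
Qed.

Section Psi1_contiguous.

Context (q p x y : C).
Context (Hq1 : (Cmod q < 1)%R) (Hp1 : (Cmod p < 1)%R)
  (Hx0 : x <> 0) (Hx1 : (Cmod x < 1)%R) (Hy0 : y <> 0) (Hy1 : (Cmod y < 1)%R).

Let Hq : 1 - q <> 0 := Cmod_lt_1_neq_1 q Hq1.
Let Hp : 1 - p <> 0 := Cmod_lt_1_neq_1 p Hp1.
Let Hqq (n : nat) : qpoch q q n <> 0 :=
  qpoch_neq_0 q q n (fun r => mult_pow_neq_1 q r Hq1).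
Let Hpp (n : nat) : qpoch p p n <> 0 :=
  qpoch_neq_0 p p n (fun r => mult_pow_neq_1 p r Hp1).

(** Here [E] stands for [q^(d-1)]. The contiguous term is the original one times
    [(1 - E q^k) / (1 - E)], and subtracting 1 from this ratio gives [E (1 - q^k) / (1 - E)]. *)
Lemma Psi1_qdiff_x (A B C' E : C) :
  E <> 0 -> (forall n, C' * p ^ n <> 1) -> (forall n, E * q ^ n <> 1) ->
  x * qdiff q (fun t => Psi1 A B C' (E * q) q p t y) x
  = (1 - E) / ((1 - q) * E)
    * (Psi1 A B C' E q p x y - Psi1 A B C' (E * q) q p x y).
Proof.
  intros HE0 HC HE; assert (HD := neq_1_shift E q HE).
  rewrite (mult_qdiff q x ((1 - E) / E *
    (Psi1 A B C' E q p x y - Psi1 A B C' (E * q) q p x y)));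
    [field; auto|exact Hq|exact Hx0|].
  apply dseries_relation; try apply Psi1_ex_dseries; auto using Cmod_mult_lt_1.
  intros l k; rewrite (qpoch_unshift E q k HE), Cpow_mult_l.
  (* The case [n = 0] of pole-freeness is [E <> 1], which permits division by [1 - E]. *)
  assert (H1 := HE 0%nat); simpl in H1; rewrite Cmult_1_r in H1.
  field; repeat split; auto using qpoch_neq_0, Cminus_neq_0.
Qed.

Lemma Psi1_qdiff_y_den (A B E D : C) :
  E <> 0 -> (forall n, E * p ^ n <> 1) -> (forall n, D * q ^ n <> 1) ->
  y * qdiff p (fun t => Psi1 A B (E * p) D q p x t) y
  = (1 - E) / ((1 - p) * E)
    * (Psi1 A B E D q p x y - Psi1 A B (E * p) D q p x y).
Proof.
  intros HE0 HE HD; assert (HC := neq_1_shift E p HE).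
  rewrite (mult_qdiff p y ((1 - E) / E *
    (Psi1 A B E D q p x y - Psi1 A B (E * p) D q p x y)));
    [field; auto|exact Hp|exact Hy0|].
  apply dseries_relation; try apply Psi1_ex_dseries; auto using Cmod_mult_lt_1.
  intros l k; rewrite (qpoch_unshift E p l HE), Cpow_mult_l.
  assert (H1 := HE 0%nat); simpl in H1; rewrite Cmult_1_r in H1.
  field; repeat split; auto using qpoch_neq_0, Cminus_neq_0.
Qed.

Lemma Psi1_qdiff_y_num (A B C' D : C) :
  B <> 0 -> (forall n, C' * p ^ n <> 1) -> (forall n, D * q ^ n <> 1) ->
  y * qdiff p (fun t => Psi1 A B C' D q p x t) y
  = (1 - B) / ((1 - p) * B)
    * (Psi1 A (B * p) C' D q p x y - Psi1 A B C' D q p x y).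
Proof.
  intros HB HC HD.
  rewrite (mult_qdiff p y ((1 - B) / B *
    (Psi1 A (B * p) C' D q p x y - Psi1 A B C' D q p x y)));
    [field; auto|exact Hp|exact Hy0|].
  apply dseries_relation; try apply Psi1_ex_dseries; auto using Cmod_mult_lt_1.
  intros l k; rewrite Cpow_mult_l.
  (* The factor [1 - B] is brought next to [(B p; p)_l] so that [qpoch_shift] applies without
     dividing by [1 - B]; the value [B = 1] is allowed here. *)
  match goal with |- _ = ?c * (?a * ?b / ?d * ?e * ?f - ?g) =>
    transitivity (a * ((1 - B) * b) / (B * d) * e * f - c * g) end.
  - rewrite qpoch_shift; field; repeat split; auto using qpoch_neq_0.
  - field; repeat split; auto using qpoch_neq_0.
Qed.

End Psi1_contiguous.

(* With [B = 0] the factor [(B; p)_l] of the terms of [Psi1] is 1. *)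
Lemma Psi2_Psi1 (A B D q p x y : C) :
  (Cmod q < 1)%R -> (Cmod p < 1)%R -> (Cmod x < 1)%R -> (Cmod y < 1)%R ->
  (forall n, B * p ^ n <> 1) -> (forall n, D * q ^ n <> 1) ->
  Psi2 A B D q p x y = Psi1 A 0 B D q p x y.
Proof.
  intros; symmetry; apply dseries_ext; [|apply Psi1_ex_dseries; assumption].
  intros l k; rewrite qpoch_0_l, Cmult_1_r; reflexivity.
Qed.

(** Agreement at [x] and [q x] suffices, and both points lie in the unit disc, where [Psi2] is known
    to equal [Psi1] with [B = 0]. *)
Lemma qdiff_ext (q x : C) (f g : C -> C) :
  f x = g x -> f (q * x) = g (q * x) -> qdiff q f x = qdiff q g x.
Proof.
  intros H1 H2; unfold qdiff; rewrite H1, H2; reflexivity.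
Qed.

(** * Pole conditions on the exponents, and the theorem *)

Lemma cpow_pole_free (lq q d : C) :
  Cexp lq = q -> (forall n : nat, cpow lq d <> / q ^ n) ->
  forall n, cpow lq d * q ^ n <> 1.
Proof.
  intros Hq H n E; apply (H n).
  assert (Hqn : q ^ n <> 0) by (apply Cpow_nz; rewrite <- Hq; apply Cexp_neq_0).
  rewrite <- (Cmult_1_l (/ q ^ n)), <- E; field; exact Hqn.
Qed.

(** Lowering [d] by one adds a single possible pole, at [n = 0], excluded by the extra hypothesis;
    the index [n + 1] reduces to the condition on [d] at [n]. *)
Lemma cpow_minus_1_pole_free (lq q d : C) :
  Cexp lq = q -> (forall n : nat, cpow lq d <> / q ^ n) -> cpow lq (d - 1) <> 1 ->
  forall n, cpow lq (d - 1) * q ^ n <> 1.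
Proof.
  intros Hq H H1 [|n]; simpl.
  - rewrite Cmult_1_r; exact H1.
  - rewrite Cmult_assoc, <- (cpow_minus_1 lq q d Hq); apply cpow_pole_free; assumption.
Qed.

Theorem theorem2p5 (q p lq lp x y : C)
    (hq0 : (0 < Cmod q)%R) (hq1 : (Cmod q < 1)%R)
    (hp0 : (0 < Cmod p)%R) (hp1 : (Cmod p < 1)%R)
    (hlq : Cexp lq = q) (hlp : Cexp lp = p)
    (hx0 : (0 < Cmod x)%R) (hx1 : (Cmod x < 1)%R)
    (hy0 : (0 < Cmod y)%R) (hy1 : (Cmod y < 1)%R) :
  (forall a b c d : C,
     (forall n : nat, cpow lp c <> / p ^ n) ->
     (forall n : nat, cpow lq d <> / q ^ n) ->
     (cpow lq (d - 1) <> 1 ->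
      x * qdiff q (fun t => Psi1 (cpow lq a) (cpow lp b) (cpow lp c) (cpow lq d) q p t y) x
      = (1 - cpow lq (d - 1)) / ((1 - q) * cpow lq (d - 1))
        * (Psi1 (cpow lq a) (cpow lp b) (cpow lp c) (cpow lq (d - 1)) q p x y
           - Psi1 (cpow lq a) (cpow lp b) (cpow lp c) (cpow lq d) q p x y))
     /\
     y * qdiff p (fun t => Psi1 (cpow lq a) (cpow lp b) (cpow lp c) (cpow lq d) q p x t) y
     = (1 - cpow lp b) / ((1 - p) * cpow lp b)
       * (Psi1 (cpow lq a) (cpow lp (b + 1)) (cpow lp c) (cpow lq d) q p x y
          - Psi1 (cpow lq a) (cpow lp b) (cpow lp c) (cpow lq d) q p x y)
     /\
     (cpow lp (c - 1) <> 1 ->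
      y * qdiff p (fun t => Psi1 (cpow lq a) (cpow lp b) (cpow lp c) (cpow lq d) q p x t) y
      = (1 - cpow lp (c - 1)) / ((1 - p) * cpow lp (c - 1))
        * (Psi1 (cpow lq a) (cpow lp b) (cpow lp (c - 1)) (cpow lq d) q p x y
           - Psi1 (cpow lq a) (cpow lp b) (cpow lp c) (cpow lq d) q p x y)))
  /\
  (forall a b c : C,
     (forall n : nat, cpow lp b <> / p ^ n) ->
     (forall n : nat, cpow lq c <> / q ^ n) ->
     (cpow lq (c - 1) <> 1 ->
      x * qdiff q (fun t => Psi2 (cpow lq a) (cpow lp b) (cpow lq c) q p t y) x
      = (1 - cpow lq (c - 1)) / ((1 - q) * cpow lq (c - 1))
        * (Psi2 (cpow lq a) (cpow lp b) (cpow lq (c - 1)) q p x y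
           - Psi2 (cpow lq a) (cpow lp b) (cpow lq c) q p x y))
     /\
     (cpow lp (b - 1) <> 1 ->
      y * qdiff p (fun t => Psi2 (cpow lq a) (cpow lp b) (cpow lq c) q p x t) y
      = (1 - cpow lp (b - 1)) / ((1 - p) * cpow lp (b - 1))
        * (Psi2 (cpow lq a) (cpow lp (b - 1)) (cpow lq c) q p x y
           - Psi2 (cpow lq a) (cpow lp b) (cpow lq c) q p x y))).
Proof.
  assert (Hx : x <> 0) by (apply Cmod_gt_0; exact hx0).
  assert (Hy : y <> 0) by (apply Cmod_gt_0; exact hy0).
  split.
  - intros a b c d Hc Hd.
    assert (HC := cpow_pole_free lp p c hlp Hc).
    assert (HD := cpow_pole_free lq q d hlq Hd).
    split; [|split].
    (* Writing [q^d] as [q^(d-1) q] puts the goal in the form with [E = q^(d-1)]. *)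
    + intros H1; rewrite (cpow_minus_1 lq q d hlq).
      apply Psi1_qdiff_x; auto using cpow_minus_1_pole_free; apply Cexp_neq_0.
    + rewrite (cpow_plus_1 lp p b hlp).
      apply Psi1_qdiff_y_num; auto; apply Cexp_neq_0.
    + intros H1; rewrite (cpow_minus_1 lp p c hlp).
      apply Psi1_qdiff_y_den; auto using cpow_minus_1_pole_free; apply Cexp_neq_0.
  - intros a b c Hb Hc.
    assert (HB := cpow_pole_free lp p b hlp Hb).
    assert (HC := cpow_pole_free lq q c hlq Hc).
    split; intros H1.
    (* Pole-freeness at [c - 1] is needed already to replace the contiguous [Psi2] by [Psi1]. *)
    + assert (HE := cpow_minus_1_pole_free lq q c hlq Hc H1).
      rewrite (qdiff_ext _ _ _ (fun t => Psi1 (cpow lq a) 0 (cpow lp b) (cpow lq c) q p t y)),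
        !Psi2_Psi1 by auto using Psi2_Psi1, Cmod_mult_lt_1.
      rewrite (cpow_minus_1 lq q c hlq).
      apply Psi1_qdiff_x; auto; apply Cexp_neq_0.
    + assert (HE := cpow_minus_1_pole_free lp p b hlp Hb H1).
      rewrite (qdiff_ext _ _ _ (fun t => Psi1 (cpow lq a) 0 (cpow lp b) (cpow lq c) q p x t)),
        !Psi2_Psi1 by auto using Psi2_Psi1, Cmod_mult_lt_1.
      rewrite (cpow_minus_1 lp p b hlp).
      apply Psi1_qdiff_y_den; auto; apply Cexp_neq_0.
Qed.
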